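(* Let $(\tilde{\mathcal M},\tilde{\mathbf c}_{\tilde\xi},\tilde k)\to(\mathcal M,H,J)$ be a perturbed Fefferman space of dimension $2m+2\ge4$ that admits an almost half-Einstein scale $\tilde\sigma$, so that off the zero set $\tilde{\mathcal Z}$ of $\tilde\sigma$, the metric $\tilde g=\tilde\sigma^{-2}\tilde{\boldsymbol g}$ is half-Einstein with constant Ricci scalar $(2m+2)\tilde\Lambda$. Then (a) $\tilde{\mathcal Z}$ is null if and only if $\tilde\Lambda=0$; (b) $\tilde{\mathcal Z}$ is spacelike if and only if $\tilde\Lambda>0$; (c) $\tilde{\mathcal Z}$ is timelike if and only if $\tilde\Lambda<0$.
   Context: $\tilde{\mathcal Z}$ is a hypersurface; it is spacelike, timelike or null if its normal (with respect to the conformal structure $\tilde{\mathbf c}_{\tilde\xi}$) is timelike, spacelike or null respectively. Signature is $(+,\dots,+,-)$. Almost CR manifolds: $(\mathcal{M},H,J)$ is an oriented smooth manifold of dimension $2m+1$ with a rank-$2m$ contact distribution $H$ and a complex structure $J$ on $H$ that is partially integrable: $[H^{(1,0)},H^{(1,0)}]\subset{}^{\mathbb C}H=H^{(1,0)}\oplus H^{(0,1)}$ ($\pm i$-eigenbundles), with positive definite Levi form. A pseudo-Hermitian structure is a positive contact form $\theta\in\Gamma(\mathrm{Ann}(H))$. The canonical bundle $\bigwedge^{m+1}\mathrm{Ann}(H^{(0,1)})$ is assumed to have a $-(m+2)$-nd root $\mathcal E(1,0)$; $\mathcal E(w,w')=\mathcal E(1,0)^w\otimes\overline{\mathcal E(1,0)}{}^{w'}$.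 There are canonical $\boldsymbol\theta\in\Gamma(T^*\mathcal M\otimes\mathcal E(1,1))$ and $\boldsymbol h_{\alpha\bar\beta}$ of weight $(1,1)$ such that each real $0<s\in\Gamma(\mathcal E(1,1))$ (CR scale) gives $\theta=s^{-1}\boldsymbol\theta$ with Levi form $h=s^{-1}\boldsymbol h$. For nowhere vanishing $\sigma\in\Gamma(\mathcal E(1,0))$, $\theta=(\sigma\bar\sigma)^{-1}\boldsymbol\theta$ is the one with $\theta\wedge(d\theta)^m=i^{m^2}m!\,\theta\wedge(\ell\lrcorner\zeta)\wedge(\ell\lrcorner\bar\zeta)$ for $\zeta=\sigma^{-(m+2)}$, $\ell$ the Reeb field ($\theta(\ell)=1$, $d\theta(\ell,\cdot)=0$). Webster connection $\nabla$ of $\theta$: unique connection preserving $\theta,d\theta$ such that for an adapted coframe $(\theta,\theta^\alpha,\bar\theta^{\bar\alpha})$, $\nabla\theta^\alpha=-\Gamma_\beta{}^\alpha\otimes\theta^\beta$, $d\theta=ih_{\alpha\bar\beta}\theta^\alpha\wedge\bar\theta^{\bar\beta}$, $d\theta^\alpha=\theta^\beta\wedge\Gamma_\beta{}^\alpha+\mathsf A^\alpha{}_{\bar\beta}\theta\wedge\bar\theta^{\bar\beta}-\frac12\mathsf N_{\bar\beta\bar\gamma}{}^\alpha\bar\theta^{\bar\beta}\wedge\bar\theta^{\bar\gamma}$, $\mathsf A_{\alpha\beta}=\mathsf A_{(\alpha\beta)}$, $\mathsf N_{\alpha\beta\gamma}=\mathsf N_{[\alpha\beta]\gamma}$, $\mathsf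 N_{[\alpha\beta\gamma]}=0$; extended to densities through the canonical bundle $\mathcal E(-m-2,0)$. $\|\mathsf N\|^2=\mathsf N_{\alpha\beta\gamma}\mathsf N^{\alpha\beta\gamma}$. With $\mathsf R_{\alpha\bar\beta\delta}{}^\gamma v^\delta=(\nabla_\alpha\nabla_{\bar\beta}-\nabla_{\bar\beta}\nabla_\alpha)v^\gamma+ih_{\alpha\bar\beta}\nabla_0v^\gamma$ ($\nabla_0$: derivative along $\ell$), $\mathsf{Ric}_\gamma{}^\delta=h^{\alpha\bar\beta}\mathsf R_{\alpha\bar\beta\gamma}{}^\delta$, $\mathsf{Sc}=\mathsf{Ric}_\gamma{}^\gamma$, set $\mathsf P=\frac1{2(m+1)}\mathsf{Sc}$. Perturbed Fefferman spaces: $\varpi:\tilde{\mathcal M}\to\mathcal M$ is the circle bundle $(\mathcal E(-1,0)\setminus0)/\mathbb R_{>0}$; a nowhere vanishing $\sigma\in\Gamma(\mathcal E(1,0))$ determines $\theta=(\sigma\bar\sigma)^{-1}\boldsymbol\theta$ and a fibre coordinate $\phi\in[-\pi,\pi)$, points being $[e^{i\phi}\sigma^{-1}]$. The Fefferman metric of $\theta$ is (pullbacks suppressed) $$\tilde g_\theta=4\theta\odot\Big(d\phi+\tfrac i2(\sigma^{-1}\nabla\sigma-\bar\sigma^{-1}\nabla\bar\sigma)-\big(\tfrac1{m+2}\mathsf P+\tfrac1{2m(m+1)}\|\mathsf N\|^2\big)\theta\Big)+h,\quad h=2h_{\alpha\bar\beta}\theta^\alpha\odot\bar\theta^{\bar\beta}.$$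 It depends only on $\theta$ and $\tilde g_{e^\varphi\theta}=e^\varphi\tilde g_\theta$; $\tilde k=\partial/\partial\phi$. Given a real semi-basic one-form $\tilde\xi$ ($\tilde\xi(\tilde k)=0$), the perturbed Fefferman metric is $\tilde g_{\theta,\tilde\xi}=\tilde g_\theta+4\theta\odot\tilde\xi$, and $\tilde{\mathbf c}_{\tilde\xi}$ is its conformal class. It carries the totally null distribution $\tilde N=(d\varpi)^{-1}(H^{(1,0)})$. Conformal scales: $n=2m$; $\tilde{\mathcal E}[w]$ are conformal density bundles, $\tilde{\boldsymbol g}_{ab}$ the conformal metric (weight $2$), $\tilde\nabla$ the Levi-Civita connection of any metric in the class; $2\tilde\nabla_{[a}\tilde\nabla_{b]}\alpha_c=-\tilde{\mathsf R}_{ab}{}^d{}_c\alpha_d$, $\widetilde{\mathsf{Ric}}_{ab}=\tilde{\mathsf R}_{ca}{}^c{}_b$, $\tilde{\mathsf P}_{ab}=\frac1n\big(\widetilde{\mathsf{Ric}}_{ab}-\frac1{2(n+1)}\widetilde{\mathsf{Sc}}\,\tilde{\boldsymbol g}_{ab}\big)$; $(\cdot)_\circ$ the trace-free part. An almost Lorentzian scale is $\tilde\sigma\in\Gamma(\tilde{\mathcal E}[1])$ with $\tilde\nabla\tilde\sigma\ne0$ on its zero set. It is an almost half-Einstein scale if $(\tilde\nabla_a\tilde\nabla_b\tilde\sigma+\tilde{\mathsf P}_{ab}\tilde\sigma)_\circ=\frac1n\tilde\Phi_{ab}\tilde\sigma$ and $\tilde\Phi_a{}^b\tilde\nabla_b\tilde\sigma-\frac1n\tilde\sigma\tilde\nabla_b\tilde\Phi_a{}^b=0$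 for some trace-free symmetric $\tilde\Phi_{ab}$ with $\tilde\Phi_{ab}\tilde v^a\tilde v^b=0$ for $\tilde v\in\Gamma(\tilde N)$. A metric is half-Einstein if $\widetilde{\mathsf{Ric}}(\tilde v,\tilde v)=0$ for $\tilde v\in\Gamma(\tilde N)$ and its Ricci scalar is constant. *)

(* Defs.v *)
From HB Require Import structures.
From mathcomp Require Import all_boot all_order all_algebra all_fingroup.
From mathcomp Require Import all_classical all_reals all_analysis.
From mathcomp.real_closed Require Import complex.
Set Implicit Arguments.
Unset Strict Implicit.
Unset Printing Implicit Defensive.
Import Order.TTheory GRing.Theory Num.Theory.
Import numFieldNormedType.Exports.
Local Open Scope classical_set_scope.
Local Open Scope ring_scope.

(* Conventions.
   - Vectors are rows, covectors are columns, bilinear forms are square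
     matrices: [w(v)] is [v *m w] and [g(v,w)] is [v *m g *m w^T].
   - The tangent space at [p] of a manifold is [R^d], identified through the
     preferred chart [chart_at p] around [p].
   - Wedge products and exterior derivatives follow the determinant
     convention, (a /\ b)(v,w) = a(v)b(w) - a(w)b(v) and
     da(X,Y) = X a(Y) - Y a(X) - a([X,Y]).
   - Sections over an open set [U] are total functions; only their values on
     [U] matter. *)

Section Calculus.
Variable R : realType.

Definition sc (K : Type) (A : 'M[K]_1) : K := A 0 0.

Definition basis_vec d (i : 'I_d) : 'rV[R]_d := delta_mx 0 i.

Definition partial d (i : 'I_d) (f : 'rV[R]_d -> R) (y : 'rV[R]_d) : R :=
  'D_(basis_vec i) f y.

Fixpoint class_C d (k : nat) (U : set 'rV[R]_d) (f : 'rV[R]_d -> R) : Prop :=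
  match k with
  | 0%N => forall y, U y -> {for y, continuous f}
  | k'.+1 => (forall y, U y -> {for y, continuous f}) /\
      (forall i : 'I_d, (forall y, U y -> derivable f y (basis_vec i)) /\
                        class_C k' U (partial i f))
  end.

Definition smooth_on d (U : set 'rV[R]_d) (f : 'rV[R]_d -> R) : Prop :=
  forall k, class_C k U f.

(* Row [i] is the [i]-th partial derivative, so [v *m pjac f y] is the
   differential of [f] applied to [v]. *)
Definition pjac d e (f : 'rV[R]_d -> 'rV[R]_e) (y : 'rV[R]_d) : 'M[R]_(d, e) :=
  \matrix_(i, j) partial i (fun z => f z 0 j) y.

End Calculus.

Section Manifolds.
Variable R : realType.

Record chart (T : topologicalType) (d : nat) := Chart {
  cdom : set T;
  cmap : T -> 'rV[R]_d;
  cinv : 'rV[R]_d -> T;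
  cdom_open : open cdom;
  cimg_open : open (cmap @` cdom);
  cmapK : forall p, cdom p -> cinv (cmap p) = p;
  cmap_continuous : forall p, cdom p -> {for p, continuous cmap};
  cinv_continuous : forall y, (cmap @` cdom) y -> {for y, continuous cinv} }.

Record manifold (d : nat) := Manifold {
  mtop :> topologicalType;
  mhausdorff : hausdorff_space mtop;
  mcountable : @second_countable mtop;
  chart_at : mtop -> chart mtop d;
  chart_at_dom : forall p, cdom (chart_at p) p;
  transition_smooth : forall (p q : mtop) (j : 'I_d),
    smooth_on (cmap (chart_at p) @` (cdom (chart_at p) `&` cdom (chart_at q)))
      (fun y => cmap (chart_at q) (cinv (chart_at p) y) 0 j) }.

Section OnManifold.
Variables (d : nat) (M : manifold d).
Implicit Types (p q : M) (U V : set M).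

Definition coords p : 'rV[R]_d := cmap (chart_at p) p.

Definition in_chart p U : set 'rV[R]_d :=
  cmap (chart_at p) @` (cdom (chart_at p) `&` U).

Definition smooth_fun U (f : M -> R) : Prop :=
  forall p, smooth_on (in_chart p U) (f \o cinv (chart_at p)).

(* Row [i] is the coordinate field [d/dx^i] of [chart_at p] at the point of
   coordinates [y], as a tangent vector at that point. *)
Definition coord_frame p (y : 'rV[R]_d) : 'M[R]_d :=
  let q := cinv (chart_at p) y in
  pjac (cmap (chart_at q) \o cinv (chart_at p)) y.

(* [v *m to_chart p q] : components in [chart_at p] of the tangent vector [v]
   at [q]. *)
Definition to_chart p q : 'M[R]_d :=
  pjac (cmap (chart_at p) \o cinv (chart_at q)) (coords q).

Definition vf_comp p (X : M -> 'rV[R]_d) (y : 'rV[R]_d) : 'rV[R]_d :=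
  let q := cinv (chart_at p) y in X q *m to_chart p q.

Definition form_comp p (w : M -> 'cV[R]_d) (y : 'rV[R]_d) : 'cV[R]_d :=
  coord_frame p y *m w (cinv (chart_at p) y).

Definition tensor_comp p (g : M -> 'M[R]_d) (y : 'rV[R]_d) : 'M[R]_d :=
  coord_frame p y *m g (cinv (chart_at p) y) *m (coord_frame p y)^T.

Definition smooth_vf U (X : M -> 'rV[R]_d) : Prop :=
  forall p j, smooth_on (in_chart p U) (fun y => vf_comp p X y 0 j).

Definition smooth_form U (w : M -> 'cV[R]_d) : Prop :=
  forall p i, smooth_on (in_chart p U) (fun y => form_comp p w y i 0).

Definition smooth_tensor U (g : M -> 'M[R]_d) : Prop :=
  forall p i j, smooth_on (in_chart p U) (fun y => tensor_comp p g y i j).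

Definition dfun (f : M -> R) p : 'cV[R]_d :=
  \col_i partial i (f \o cinv (chart_at p)) (coords p).

Definition extd (w : M -> 'cV[R]_d) p : 'M[R]_d :=
  \matrix_(i, j) (partial i (fun y => form_comp p w y j 0) (coords p)
                  - partial j (fun y => form_comp p w y i 0) (coords p)).

Definition lie (X Y : M -> 'rV[R]_d) p : 'rV[R]_d :=
  X p *m pjac (vf_comp p Y) (coords p) - Y p *m pjac (vf_comp p X) (coords p).

End OnManifold.

Section Maps.
Variables (d e : nat) (M : manifold d) (N : manifold e).

Definition smooth_map (F : M -> N) : Prop :=
  continuous F /\ forall (U : set N) (f : N -> R),
    open U -> smooth_fun U f -> smooth_fun (F @^-1` U) (f \o F).

(* [v *m tangent_map F x] is [dF_x(v)]; dually [tangent_map F x *m w] is the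
   pullback of the covector [w]. *)
Definition tangent_map (F : M -> N) (x : M) : 'M[R]_(d, e) :=
  pjac (cmap (chart_at (F x)) \o F \o cinv (chart_at x)) (coords x).

End Maps.
End Manifolds.

Section ComplexFields.
Variable R : realType.
Local Notation C := R[i].

Definition iC : C := Complex 0 1.
Definition toC (x : R) : C := Complex x 0.
Definition mxC m n (A : 'M[R]_(m, n)) : 'M[C]_(m, n) := map_mx toC A.
Definition mxRe m n (A : 'M[C]_(m, n)) : 'M[R]_(m, n) := map_mx (@complex.Re R) A.
Definition mxIm m n (A : 'M[C]_(m, n)) : 'M[R]_(m, n) := map_mx (@complex.Im R) A.
Definition mxconj m n (A : 'M[C]_(m, n)) : 'M[C]_(m, n) := map_mx conjc A.
Definition cplx m n (A B : 'M[R]_(m, n)) : 'M[C]_(m, n) :=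
  mxC A + iC *: mxC B.

Variables (d : nat) (M : manifold R d).
Implicit Types (p : M) (U V : set M).

Definition smooth_funC U (f : M -> C) : Prop :=
  smooth_fun U (fun p => complex.Re (f p)) /\ smooth_fun U (fun p => complex.Im (f p)).
Definition smooth_vfC U (X : M -> 'rV[C]_d) : Prop :=
  smooth_vf U (fun p => mxRe (X p)) /\ smooth_vf U (fun p => mxIm (X p)).
Definition smooth_formC U (w : M -> 'cV[C]_d) : Prop :=
  smooth_form U (fun p => mxRe (w p)) /\ smooth_form U (fun p => mxIm (w p)).

Definition dfunC (f : M -> C) p : 'cV[C]_d :=
  cplx (dfun (fun q => complex.Re (f q)) p) (dfun (fun q => complex.Im (f q)) p).
Definition extdC (w : M -> 'cV[C]_d) p : 'M[C]_d :=
  cplx (extd (fun q => mxRe (w q)) p) (extd (fun q => mxIm (w q)) p).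
Definition lieC (X Y : M -> 'rV[C]_d) p : 'rV[C]_d :=
  cplx (lie (fun q => mxRe (X q)) (fun q => mxRe (Y q)) p
        - lie (fun q => mxIm (X q)) (fun q => mxIm (Y q)) p)
       (lie (fun q => mxRe (X q)) (fun q => mxIm (Y q)) p
        + lie (fun q => mxIm (X q)) (fun q => mxRe (Y q)) p).

(* Derivative of [f] along the complex tangent vector [v] at [p]. *)
Definition ddir (v : 'rV[C]_d) (f : M -> C) p : C := sc (v *m dfunC f p).

End ComplexFields.

Section ExteriorAlgebra.
Variables (R : realType) (d : nat).
Local Notation C := R[i].

Definition wedge11 (a b : 'cV[C]_d) : 'M[C]_d := a *m b^T - b *m a^T.
Definition symprod (K : fieldType) n (a b : 'cV[K]_n) : 'M[K]_n :=
  2%:R^-1 *: (a *m b^T + b *m a^T).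

(* Complex multilinear forms take a sequence of vectors; a form of degree [k]
   only depends on the first [k] of them. *)
Definition mform := (nat -> 'rV[C]_d) -> C.

Definition mform1 (a : 'cV[C]_d) : mform := fun v => sc (v 0%N *m a).
Definition mform2 (D : 'M[C]_d) : mform :=
  fun v => sc (v 0%N *m D *m (v 1%N)^T).

Definition perm_nat n (s : 'S_n) (i : nat) : nat :=
  if insub i is Some o then val (s o) else i.

Definition wedge (k l : nat) (a b : mform) : mform := fun v =>
  (k`!%:R * l`!%:R)^-1 *
  \sum_(s : 'S_(k + l)) (-1) ^+ s * a (fun i => v (perm_nat s i))
                                  * b (fun j => v (perm_nat s (k + j)%N)).

Fixpoint wedge2_pow (a : mform) (m : nat) : mform :=
  if m is m'.+1 then wedge 2 m'.*2 a (wedge2_pow a m') else fun=> 1.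

Definition contract (l : 'rV[C]_d) (a : mform) : mform :=
  fun v => a (fun i => if i is j.+1 then v j else l).

Definition mform_conj (a : mform) : mform :=
  fun v => conjc (a (fun i => mxconj (v i))).

Definition upd (v : nat -> 'rV[C]_d) (i : nat) (x : 'rV[C]_d) :=
  fun j => if j == i then x else v j.

Definition alternating (k : nat) (a : mform) : Prop :=
  [/\ forall v w, (forall i, (i < k)%N -> v i = w i) -> a v = a w,
      forall v i (t : C) x y, (i < k)%N ->
        a (upd v i (t *: x + y)) = t * a (upd v i x) + a (upd v i y) &
      forall v i j, (i < j < k)%N -> v i = v j -> a v = 0].

End ExteriorAlgebra.

Section AlmostCR.
Variables (R : realType) (m : nat) (M : manifold R m.*2.+1).
Local Notation C := R[i].
Local Notation d := (m.*2.+1).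
Implicit Types (p : M) (U V : set M).

Section RawCR.
Variables (o : M -> bool) (H : M -> {vspace 'rV[R]_d}) (J : M -> 'M[R]_d).

(* [o p] tells whether the standard basis of the tangent space at [p] (that
   is, the coordinate basis of [chart_at p]) is negatively oriented. *)
Definition orientation : Prop := forall p, \forall q \near p,
  0 < (-1) ^+ (o p) * (-1) ^+ (o q) * \det (to_chart p q).

Definition contact_form_on U (theta : M -> 'cV[R]_d) : Prop :=
  [/\ smooth_form U theta,
      (forall p, U p -> forall v, v \in H p <-> v *m theta p = 0) &
      forall p, U p -> exists v,
        wedge 1 m.*2 (mform1 (mxC (theta p)))
          (wedge2_pow (mform2 (mxC (extd theta p))) m) v != 0].

Definition hol p (v : 'rV[C]_d) : Prop :=
  [/\ mxRe v \in H p, mxIm v \in H p & v *m mxC (J p) = iC R *: v].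

(* Rows: t, e_0, J e_0, e_1, J e_1, ... *)
Definition CR_basis p (t : 'rV[R]_d) (e : nat -> 'rV[R]_d) : 'M[R]_d :=
  \matrix_(k < d, j < d)
    (if val k is k'.+1 then
       if odd k' then e k'./2 *m J p else e k'./2
     else t) 0 j.

(* A contact form is positive for the orientation of TM/H induced by the
   orientation of M and the orientation of H by J. *)
Definition positive_contact_on U (theta : M -> 'cV[R]_d) : Prop :=
  contact_form_on U theta /\
  forall p, U p -> forall t e, (forall i, e i \in H p) ->
    0 < sc (t *m theta p) -> CR_basis p t e \in unitmx ->
    0 < (-1) ^+ (o p) * \det (CR_basis p t e).

Definition levi (theta : M -> 'cV[R]_d) p (v w : 'rV[C]_d) : C :=
  - iC R * sc (v *m mxC (extd theta p) *m (mxconj w)^T).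

End RawCR.

(* [CR_J p] only matters on [CR_H p]. *)
Record almost_CR := AlmostCR {
  CR_or : M -> bool;
  CR_H : M -> {vspace 'rV[R]_d};
  CR_J : M -> 'M[R]_d;
  CR_orP : orientation CR_or;
  CR_rank : forall p, \dim (CR_H p) = m.*2;
  CR_contact : forall p, exists U theta,
    [/\ open U, U p & contact_form_on CR_H U theta];
  CR_J_stable : forall p v, v \in CR_H p -> v *m CR_J p \in CR_H p;
  CR_J_sqr : forall p v, v \in CR_H p -> v *m CR_J p *m CR_J p = - v;
  CR_J_smooth : forall U X, open U -> smooth_vf U X ->
    (forall p, U p -> X p \in CR_H p) ->
    smooth_vf U (fun p => X p *m CR_J p);
  CR_integrable : forall U X Y, open U -> smooth_vfC U X -> smooth_vfC U Y ->
    (forall p, U p -> hol CR_H CR_J p (X p)) ->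
    (forall p, U p -> hol CR_H CR_J p (Y p)) ->
    forall p, U p ->
      mxRe (lieC X Y p) \in CR_H p /\ mxIm (lieC X Y p) \in CR_H p;
  CR_levi : forall U theta, open U ->
    positive_contact_on CR_or CR_H CR_J U theta ->
    forall p v, U p -> hol CR_H CR_J p v -> v != 0 -> 0 < levi theta p v v }.

Variable X : almost_CR.

Definition H10 p : set 'rV[C]_d := [set v | hol (CR_H X) (CR_J X) p v].
Definition H01 p : set 'rV[C]_d := [set v | H10 p (mxconj v)].

Definition positive_contact U theta : Prop :=
  positive_contact_on (CR_or X) (CR_H X) (CR_J X) U theta.

Definition reeb (theta : M -> 'cV[R]_d) p (l : 'rV[R]_d) : Prop :=
  sc (l *m theta p) = 1 /\ l *m extd theta p = 0.

(* Webster connection of [theta] over [U] in an adapted coframe: [w_frm] is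
   dual to the coframe, [w_Gam b a] is Gamma_b^a, [w_A a b] is A^a_{bar b},
   [w_N b c a] is N_{bar b bar c}^a and [w_R a b e c] is R_{a bar b e}^c. *)
Section Webster.
Variables (U : set M) (theta : M -> 'cV[R]_d).

Section RawWebster.
Variables (ell : M -> 'rV[R]_d).
Variables (cof : 'I_m -> M -> 'cV[C]_d) (frm : 'I_m -> M -> 'rV[C]_d).
Variables (h : M -> 'M[C]_m) (Gam : 'I_m -> 'I_m -> M -> 'cV[C]_d).
Variables (A : M -> 'M[C]_m) (N : 'I_m -> 'I_m -> 'I_m -> M -> C).
Variables (Rm : 'I_m -> 'I_m -> 'I_m -> 'I_m -> M -> C).

Definition adapted_coframe : Prop := forall p, U p ->
  [/\ reeb theta p (ell p),
      (forall a v, H01 p v -> v *m cof a p = 0),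
      (forall a, mxC (ell p) *m cof a p = 0),
      (forall a, H10 p (frm a p)) &
      forall a b, sc (frm a p *m cof b p) = (a == b)%:R].

Definition conn_vec (v : 'I_m -> M -> C) (c : 'I_m) (Z : M -> 'rV[C]_d) p : C :=
  ddir (Z p) (v c) p + \sum_e sc (Z p *m Gam e c p) * v e p.

Definition frm_bar (b : 'I_m) p : 'rV[C]_d := mxconj (frm b p).

(* The components [nabla_a nabla_{bar b} v^c] and [nabla_{bar b} nabla_a v^c]
   of the second covariant derivative of [v]. *)
Definition nabla2_a_bbar v (a b c : 'I_m) p : C :=
  ddir (frm a p) (conn_vec v c (frm_bar b)) p
  + \sum_e sc (frm a p *m Gam e c p) * conn_vec v e (frm_bar b) p
  - \sum_e sc (frm a p *m mxconj (Gam b e p)) * conn_vec v c (frm_bar e) p.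

Definition nabla2_bbar_a v (a b c : 'I_m) p : C :=
  ddir (frm_bar b p) (conn_vec v c (frm a)) p
  + \sum_e sc (frm_bar b p *m Gam e c p) * conn_vec v e (frm a) p
  - \sum_e sc (frm_bar b p *m Gam a e p) * conn_vec v c (frm e) p.

Definition N_bar (b c e : 'I_m) p : C := \sum_a N b c a p * h p a e.

Record is_webster : Prop := IsWebster {
  w_adapted : adapted_coframe;
  w_cof_smooth : forall a, smooth_formC U (cof a);
  w_Gam_smooth : forall a b, smooth_formC U (Gam a b);
  w_dtheta : forall p, U p -> mxC (extd theta p) =
    iC R *: \sum_a \sum_b h p a b *: wedge11 (cof a p) (mxconj (cof b p));
  w_dcof : forall a p, U p -> extdC (cof a) p =
    \sum_b wedge11 (cof b p) (Gam b a p)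
    + \sum_b A p a b *: wedge11 (mxC (theta p)) (mxconj (cof b p))
    - 2%:R^-1 *: \sum_b \sum_c
        N b c a p *: wedge11 (mxconj (cof b p)) (mxconj (cof c p));
  (* dtheta, equivalently the Levi form h, is parallel *)
  w_parallel : forall a b p, U p ->
    dfunC (fun q => h q a b) p =
      \sum_c h p c b *: Gam a c p + \sum_c h p a c *: mxconj (Gam b c p);
  w_A_sym : forall p b c, U p ->
    \sum_a A p a b * h p a c = \sum_a A p a c * h p a b;
  w_N_skew : forall b c e p, U p -> N_bar b c e p = - N_bar c b e p;
  w_N_cyclic : forall b c e p, U p ->
    N_bar b c e p + N_bar c e b p + N_bar e b c p = 0;
  w_curvature : forall (v : 'I_m -> M -> C),
    (forall c, smooth_funC U (v c)) -> forall a b c p, U p ->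
    \sum_e Rm a b e c p * v e p =
      nabla2_a_bbar v a b c p - nabla2_bbar_a v a b c p
      + iC R * h p a b * conn_vec v c (fun q => mxC (ell q)) p }.

End RawWebster.

Record webster := Webster {
  w_ell : M -> 'rV[R]_d;
  w_cof : 'I_m -> M -> 'cV[C]_d;
  w_frm : 'I_m -> M -> 'rV[C]_d;
  w_h : M -> 'M[C]_m;
  w_Gam : 'I_m -> 'I_m -> M -> 'cV[C]_d;
  w_A : M -> 'M[C]_m;
  w_N : 'I_m -> 'I_m -> 'I_m -> M -> C;
  w_R : 'I_m -> 'I_m -> 'I_m -> 'I_m -> M -> C;
  w_spec : is_webster w_ell w_cof w_frm w_h w_Gam w_A w_N w_R }.

Variable W : webster.

(* h^{a bar b}, with h^{a bar b} h_{c bar b} = delta^a_c. *)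
Definition w_hinv p (a b : 'I_m) : C := invmx (w_h W p) b a.

Definition w_Ric (c e : 'I_m) p : C :=
  \sum_a \sum_b w_hinv p a b * w_R W a b c e p.
Definition w_Sc p : C := \sum_c w_Ric c c p.
Definition w_P p : C := (2 * m.+1)%:R^-1 * w_Sc p.

(* N_{abc} N^{abc}, where N_{abc} is the conjugate of N_{bar a bar b bar c}. *)
Definition w_normN p : C :=
  let Nb := N_bar (w_h W) (w_N W) in
  \sum_a \sum_b \sum_c \sum_a' \sum_b' \sum_c'
    conjc (Nb a b c p) * Nb a' b' c' p
    * w_hinv p a a' * w_hinv p b b' * w_hinv p c c'.

End Webster.

(* The fibre at [p] of the canonical bundle. *)
Definition canonical_form p (z : mform R d) : Prop :=
  alternating m.+1 z /\ forall v, H01 p (v 0%N) -> z v = 0.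

Definition smooth_mform U (z : M -> mform R d) : Prop :=
  forall V (Y : nat -> M -> 'rV[C]_d), open V -> V `<=` U ->
    (forall i, smooth_vfC V (Y i)) ->
    smooth_funC V (fun p => z p (fun i => Y i p)).

(* The density bundle E(-1,0), i.e. the dual of E(1,0): a complex line bundle
   with an identification [t |-> t^(m+2)] of its (m+2)-nd power with the
   canonical bundle E(-m-2,0). A nowhere vanishing section sigma of E(1,0) is
   given by the nowhere vanishing section tau = sigma^-1 of E(-1,0).
   [E_sec U t] : the section [t] is smooth over the open set [U]. *)
Record density_root := DensityRoot {
  E_fib : M -> lmodType C;
  E_line : forall p, exists2 e : E_fib p, e != 0 &
    forall v, exists a : C, v = a *: e;
  E_sec : set M -> (forall p, E_fib p) -> Prop;
  E_sec_local : forall U t, open U -> (E_sec U t <->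
    forall p, U p -> exists V, [/\ open V, V p, V `<=` U & E_sec V t]);
  E_triv : forall p, exists U t,
    [/\ open U, U p, E_sec U t & forall q, U q -> t q != 0];
  E_frame : forall U V t s (a : M -> C), open U -> open V -> V `<=` U ->
    E_sec U t -> (forall q, U q -> t q != 0) ->
    (forall q, V q -> s q = a q *: t q) -> (E_sec V s <-> smooth_funC V a);
  E_pow : forall p, E_fib p -> mform R d;
  E_pow_canonical : forall p (t : E_fib p), canonical_form p (E_pow t);
  E_powZ : forall p (t : E_fib p) (a : C) v,
    E_pow (a *: t) v = a ^+ m.+2 * E_pow t v;
  E_pow_neq0 : forall p (t : E_fib p), t != 0 -> exists v, E_pow t v != 0;
  E_pow_smooth : forall U t, open U -> E_sec U t ->
    smooth_mform U (fun p => E_pow (t p)) }.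

Variable E : density_root.

Definition local_frame U (t : forall p, E_fib E p) : Prop :=
  [/\ open U, E_sec U t & forall p, U p -> t p != 0].

(* theta = (sigma sigma-bar)^-1 bold-theta on U, for sigma = t^-1. *)
Definition volume_normalised U (theta : M -> 'cV[R]_d)
    (t : forall p, E_fib E p) : Prop :=
  forall p l, U p -> reeb theta p l ->
  let z := contract (mxC l) (E_pow (t p)) in
  let th := mform1 (mxC (theta p)) in
  forall v,
    wedge 1 m.*2 th (wedge2_pow (mform2 (mxC (extd theta p))) m) v =
    iC R ^+ (m ^ 2) * m`!%:R * wedge m.+1 m (wedge 1 m th z) (mform_conj z) v.

(* sigma^-1 nabla sigma for sigma = t^-1 and the Webster connection [W].
   With t^(m+2) = c theta /\ theta^1 /\ ... /\ theta^m one has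
   nabla (t^(m+2)) = (dc - c Gamma_a^a) (x) theta /\ theta^1 /\ ... /\ theta^m,
   and t^(m+2) = sigma^-(m+2). *)
Definition log_nabla U theta (W : webster U theta)
    (t : forall p, E_fib E p) (p : M) : 'cV[C]_d :=
  let c q := E_pow (t q) (fun i =>
    if i is j.+1 then oapp (fun a => w_frm W a q) 0 (insub j)
    else mxC (w_ell W q)) in
  - (m.+2%:R^-1 *: ((c p)^-1 *: dfunC c p - \sum_a w_Gam W a a p)).

(* The circle bundle (E(-1,0) \ 0)/R_{>0}: [F_cls v] is the class of [v]
   (irrelevant for [v = 0]). Its smooth structure is the one making every local
   trivialisation [[u tau(p)] |-> (p, u)] a diffeomorphism; as this map is
   bijective between manifolds of the same dimension, it is enough that it be a
   smooth immersion. *)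
Section RawCircle.
Variables (T : manifold R m.*2.+2) (pr : T -> M).
Variable (cls : forall p, E_fib E p -> T).

(* [u] is e^{i phi} for the fibre coordinate phi of sigma = t^-1. *)
Definition is_fibre_coord U (t : forall p, E_fib E p) (u : T -> C) : Prop :=
  local_frame U t /\
  forall x, U (pr x) ->
    u x * conjc (u x) = 1 /\ cls (u x *: t (pr x)) = x.
End RawCircle.

Record circle_bundle := CircleBundle {
  F_tot :> manifold R m.*2.+2;
  F_pr : F_tot -> M;
  F_cls : forall p, E_fib E p -> F_tot;
  F_cls_pr : forall p (v : E_fib E p), v != 0 -> F_pr (F_cls v) = p;
  F_cls_eq : forall p (v w : E_fib E p), v != 0 -> w != 0 ->
    (F_cls v = F_cls w <-> exists2 r : R, 0 < r & w = toC r *: v);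
  F_cls_onto : forall x : F_tot, exists2 v : E_fib E (F_pr x), v != 0 &
    F_cls v = x;
  F_pr_smooth : smooth_map F_pr;
  F_coord_smooth : forall U t u, is_fibre_coord F_pr F_cls U t u ->
    smooth_funC (F_pr @^-1` U) u;
  F_coord_immersion : forall U t u, is_fibre_coord F_pr F_cls U t u ->
    forall x (v : 'rV[R]_(m.*2.+2)), U (F_pr x) ->
      v *m tangent_map F_pr x = 0 ->
      mxC v *m dfunC u x = 0 -> v = 0 }.

End AlmostCR.

(* Classical coordinate expressions, in the chart [chart_at p] at the point of
   coordinates [y], for the Levi-Civita connection of the metric [g]. *)
Section LeviCivita.
Variables (R : realType) (n : nat) (M : manifold R n.+2).
Local Notation N := (n.+2).
Implicit Types (g Phi : M -> 'M[R]_N) (p : M) (y : 'rV[R]_N).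

Definition ginv g p y : 'M[R]_N := invmx (tensor_comp p g y).

(* Gamma^k_{ij} *)
Definition christoffel g p (k i j : 'I_N) y : R :=
  2%:R^-1 * \sum_l ginv g p y k l *
    (partial i (fun z => tensor_comp p g z l j) y
     + partial j (fun z => tensor_comp p g z l i) y
     - partial l (fun z => tensor_comp p g z i j) y).

(* R_{ab}^e_c, with 2 nabla_[a nabla_b] alpha_c = - R_{ab}^e_c alpha_e *)
Definition riemann g p (a b e c : 'I_N) y : R :=
  partial a (christoffel g p e b c) y - partial b (christoffel g p e a c) y
  + \sum_f (christoffel g p e a f y * christoffel g p f b c y
            - christoffel g p e b f y * christoffel g p f a c y).

Definition ricci g p y : 'M[R]_N := \matrix_(a, b) \sum_c riemann g p c a c b y.

Definition metric_trace g p y (T : 'M[R]_N) : R :=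
  \sum_a \sum_b ginv g p y a b * T a b.

Definition trace_free_part g p y (T : 'M[R]_N) : 'M[R]_N :=
  T - (N%:R^-1 * metric_trace g p y T) *: tensor_comp p g y.

Definition scalar_curv g p y : R := metric_trace g p y (ricci g p y).

(* P_{ab}; the dimension is n + 2. *)
Definition schouten g p y : 'M[R]_N :=
  n%:R^-1 *: (ricci g p y
              - ((2 * n.+1)%:R^-1 * scalar_curv g p y) *: tensor_comp p g y).

Definition hessian g p (f : M -> R) y : 'M[R]_N :=
  let F := f \o cinv (chart_at p) in
  \matrix_(a, b) (partial a (partial b F) y
                  - \sum_k christoffel g p k a b y * partial k F y).

(* nabla_c Phi_{ab} *)
Definition nabla_tensor g p Phi (c a b : 'I_N) y : R :=
  partial c (fun z => tensor_comp p Phi z a b) y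
  - \sum_e christoffel g p e c a y * tensor_comp p Phi y e b
  - \sum_e christoffel g p e c b y * tensor_comp p Phi y a e.

(* nabla_b Phi_a^b *)
Definition divergence g p Phi y (a : 'I_N) : R :=
  \sum_b \sum_c ginv g p y b c * nabla_tensor g p Phi b a c y.

(* Phi_a^b nabla_b f *)
Definition raise_apply g p Phi (f : M -> R) y (a : 'I_N) : R :=
  \sum_b \sum_c tensor_comp p Phi y a c * ginv g p y c b *
    partial b (f \o cinv (chart_at p)) y.

Definition lorentzian g : Prop :=
  smooth_tensor setT g /\ forall x, exists2 B : 'M[R]_N, B \in unitmx &
    B *m g x *m B^T = diag_mx (\row_j (if j == ord_max then -1 else 1)).

Definition conformal_class (g0 : M -> 'M[R]_N) : set (M -> 'M[R]_N) :=
  [set g | lorentzian g /\ exists Om : M -> R,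
    [/\ smooth_fun setT Om, (forall x, 0 < Om x) &
        forall x, g x = Om x ^+ 2 *: g0 x]].

(* A density assigns to each metric of the class the function that represents
   it in the corresponding trivialisation. *)
Definition density := (M -> 'M[R]_N) -> M -> R.

Definition is_density (w : int) (c : set (M -> 'M[R]_N)) (s : density) : Prop :=
  forall g, c g -> smooth_fun setT (s g) /\
    forall Om : M -> R, smooth_fun setT Om -> (forall x, 0 < Om x) ->
      forall x, s (fun z => Om z ^+ 2 *: g z) x = Om x ^ w * s g x.

(* The zero set of a density, the same for all [g] in the class. *)
Definition zero_set (s : density) g : set M := [set x | s g x = 0].

(* The metric s^-2 bold-g off the zero set, the same for all [g] in the class
   when [s] has weight 1. *)
Definition scale_metric (s : density) g : M -> 'M[R]_N :=
  fun x => (s g x ^+ 2)^-1 *: g x.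

Definition almost_lorentzian_scale (c : set (M -> 'M[R]_N)) (s : density) : Prop :=
  is_density 1 c s /\
  forall g x, c g -> zero_set s g x -> dfun (s g) x != 0.

(* [v] is normal, for [g], to the hypersurface [f = 0] at the point [x]; the
   tangent space of the hypersurface is the kernel of [df]. *)
Definition is_normal g (f : M -> R) (x : M) (v : 'rV[R]_N) : Prop :=
  v != 0 /\ forall w : 'rV[R]_N, w *m dfun f x = 0 -> v *m g x *m w^T = 0.

Definition zero_set_normals (P : R -> Prop) (c : set (M -> 'M[R]_N))
    (s : density) : Prop :=
  forall g x v, c g -> zero_set s g x -> is_normal g (s g) x v ->
    P (sc (v *m g x *m v^T)).

Definition zero_set_spacelike c s := zero_set_normals (fun q => q < 0) c s.
Definition zero_set_timelike c s := zero_set_normals (fun q => 0 < q) c s.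
Definition zero_set_null c s := zero_set_normals (fun q => q = 0) c s.

Definition const_scalar_curv (U : set M) g (k : R) : Prop :=
  forall p x, cdom (chart_at p) x -> U x ->
    scalar_curv g p (cmap (chart_at p) x) = k.

(* The notions below refer to a complex distribution [D] on M. *)
Variable D : M -> set 'rV[R[i]]_N.

Definition almost_half_einstein_scale c (s : density) : Prop :=
  almost_lorentzian_scale c s /\
  exists Phi : M -> 'M[R]_N,
  [/\ smooth_tensor setT Phi,
      (forall x, (Phi x)^T = Phi x),
      (forall x v, D x v -> v *m mxC (Phi x) *m v^T = 0) &
      forall g, c g -> forall p x, cdom (chart_at p) x ->
        let y := cmap (chart_at p) x in
        [/\ metric_trace g p y (tensor_comp p Phi y) = 0,
            trace_free_part g p y (hessian g p (s g) y + s g x *: schouten g p y)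
              = (n%:R^-1 * s g x) *: tensor_comp p Phi y &
            forall a, raise_apply g p Phi (s g) y a
              - n%:R^-1 * s g x * divergence g p Phi y a = 0]].

Definition half_einstein_on (U : set M) g : Prop :=
  (forall p x v, cdom (chart_at p) x -> U x -> D x v ->
     let w := v *m mxC (to_chart p x) in
     w *m mxC (ricci g p (cmap (chart_at p) x)) *m w^T = 0)
  /\ exists k, const_scalar_curv U g k.

End LeviCivita.

Section Fefferman.
Variables (R : realType) (m : nat) (M : manifold R m.*2.+1).
Variables (X : almost_CR M) (E : density_root X) (F : circle_bundle E).
Local Notation C := R[i].
Local Notation pr := (@F_pr R m M X E F).
Local Notation dpr := (tangent_map pr).

(* The vector field d/dphi. *)
Definition fibre_generator (k : F -> 'rV[R]_(m.*2.+2)) : Prop :=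
  forall x, k x *m dpr x = 0 /\
    forall U t u, is_fibre_coord pr (@F_cls R m M X E F) U t u -> U (pr x) ->
      sc (mxC (k x) *m dfunC u x) = iC R * u x.

Definition semi_basic (k : F -> 'rV[R]_(m.*2.+2)) (xi : F -> 'cV[R]_(m.*2.+2)) :=
  smooth_form setT xi /\ forall x, k x *m xi x = 0.

(* (d pr)^-1 (H^(1,0)) *)
Definition Ntilde (x : F) : set 'rV[C]_(m.*2.+2) :=
  [set v | H10 X (pr x) (v *m mxC (dpr x))].

(* With u = e^{i phi}, [- i u^-1 du] is dphi. *)
Definition fefferman_metric (theta : M -> 'cV[R]_(m.*2.+1))
    (g : F -> 'M[R]_(m.*2.+2)) : Prop :=
  forall x0 : F, exists U t u (W : webster X U theta),
  [/\ U (pr x0), is_fibre_coord pr (@F_cls R m M X E F) U t u,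
      volume_normalised U theta t &
      forall x, U (pr x) ->
        let p := pr x in
        let A := mxC (dpr x) in
        let th := A *m mxC (theta p) in
        let ls := log_nabla W t p in
        let lam := - (iC R * (u x)^-1) *: dfunC u x
          + A *m ((iC R / 2%:R) *: (ls - mxconj ls))
          - ((m.+2)%:R^-1 * w_P W p + (2 * m * m.+1)%:R^-1 * w_normN W p) *: th in
        mxC (g x) = 4%:R *: symprod th lam
          + 2%:R *: \sum_a \sum_b w_h W p a b *:
              symprod (A *m w_cof W a p) (A *m mxconj (w_cof W b p))].

Definition perturbed_metric (theta : M -> 'cV[R]_(m.*2.+1))
    (xi : F -> 'cV[R]_(m.*2.+2)) (g : F -> 'M[R]_(m.*2.+2)) :
    F -> 'M[R]_(m.*2.+2) :=
  fun x => g x + 4%:R *: symprod (dpr x *m theta (pr x)) (xi x).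

Definition perturbed_fefferman_space (k : F -> 'rV[R]_(m.*2.+2))
    (xi : F -> 'cV[R]_(m.*2.+2)) (c : set (F -> 'M[R]_(m.*2.+2))) : Prop :=
  [/\ fibre_generator k, semi_basic k xi &
      exists theta g, [/\ positive_contact X setT theta,
        fefferman_metric theta g &
        c = conformal_class (perturbed_metric theta xi g)]].

End Fefferman.

(* Main.v *)
Require Import Defs.
From mathcomp Require Import all_boot all_order all_algebra.
From mathcomp Require Import all_classical all_reals all_analysis.
From mathcomp Require Import ring.
Import Order.TTheory GRing.Theory Num.Theory.
Import numFieldNormedType.Exports.
Set Implicit Arguments.
Unset Strict Implicit.
Local Open Scope classical_set_scope.
Local Open Scope ring_scope.

(** The causal type of the zero set is read off from the conformal
    transformation law of the scalar curvature, extended by continuity to the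
    zero set.

    Let g be a metric of the conformal class, sigma the function representing
    the scale in it, N the dimension and ghat = sigma^-2 g. Off the zero set,

      Sc(ghat) = sigma^2 Sc(g) + sigma L - N (N - 1) |d sigma|^2,

    where L is smooth across the zero set. Only the last term survives on the
    zero set, so no second derivative of sigma or g has to be computed: the
    Levi-Civita connection of ghat is Gamma - sigma^-1 C, with C the tensor
    [conf_diff] built algebraically from g and d sigma, and in
    sigma^2 Riem(ghat) the only terms without a factor sigma are quadratic in
    d sigma. Their contraction is a computation with Kronecker deltas,
    [conf_diff_scalar].

    The right-hand side is thus a smooth function F, [scaled_scalar_curv],
    which equals N Lambda wherever sigma <> 0. As d sigma <> 0 on the zero set,
    sigma vanishes on no neighbourhood of a zero p, so F(p) = N Lambda by
    continuity ([scalar_curv_at_zero]), that is,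
    Lambda = - (N - 1) |d sigma|^2 at p.

    Finally a normal v at p is a nonzero multiple of the gradient of sigma, so
    g(v,v) is a positive multiple of |d sigma|^2 and hence a negative multiple
    of Lambda ([normal_sqnorm_sign]). Each equivalence follows, the zero set
    being nonempty and every point of it having a normal.

    All of this is local, and at a given point p everything is computed in the
    chart centred at p: there the coordinate frame is the identity
    ([coord_frame_centre]), so that nondegeneracy of the components of g near p
    follows by continuity of the determinant. *)

(** * Calculus of smooth functions on open sets *)

Section SmoothFunctions.
Variables (R : realType) (d : nat).
Implicit Types (U V : set 'rV[R]_d) (f g : 'rV[R]_d -> R) (k : nat).

Lemma near_open U (y : 'rV[R]_d) : open U -> U y -> \forall z \near y, U z.
Proof. by move=> oU Uy; exact: open_nbhs_nbhs. Qed.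

Lemma near_eq_on U f g y : open U -> U y -> (forall z, U z -> f z = g z) ->
  \forall z \near y, f z = g z.
Proof. by move=> oU Uy fg; apply: filterS (near_open oU Uy) => z /fg. Qed.

Lemma partial_eq_on U f g i y : open U -> U y -> (forall z, U z -> f z = g z) ->
  partial i f y = partial i g y.
Proof.
by move=> oU Uy fg; apply: near_eq_derive; exact: near_eq_on fg.
Qed.

(** Partial derivatives of a sum, product or inverse are given by the usual
    formulas only where the functions are differentiable. The inductions below
    therefore identify them on the open set alone, and this congruence carries
    regularity across. *)
Lemma class_C_eq k U f g : open U -> (forall z, U z -> f z = g z) ->
  class_C k U f -> class_C k U g.
Proof.
move=> oU; have Ceq f' g' : (forall z, U z -> f' z = g' z) ->
    forall y, U y -> {for y, continuous f'} -> {for y, continuous g'}.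
  move=> fg y Uy cf; suff: g' @ y --> f' y by rewrite (fg y Uy).
  by apply: cvg_trans cf; exact: near_eq_cvg (near_eq_on oU Uy fg).
elim: k f g => [|k IH] f g fg /=.
  by move=> cf y Uy; apply: Ceq (cf y Uy).
move=> [cf df]; split=> [y Uy|i]; first exact: Ceq (cf y Uy).
have [dfi Ci] := df i; split=> [y Uy|]; last first.
  by apply: IH Ci => z Uz; exact: partial_eq_on fg.
apply: near_eq_derivable (dfi y Uy).
exact: near_eq_on fg.
Qed.

Lemma class_C_sub k U V f : V `<=` U -> class_C k U f -> class_C k V f.
Proof.
move=> VU; elim: k f => [|k IH] f /=; first by move=> cf y /VU /cf.
move=> [cf df]; split=> [y /VU /cf //|i].
by have [dfi /IH ?] := df i; split=> // y /VU /dfi.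
Qed.

(** The product and inverse rules bring back the function itself along with its
    derivatives, so the inductions on the order need to lower it. *)
Lemma class_C_pred k U f : class_C k.+1 U f -> class_C k U f.
Proof.
elim: k f => [|k IH] f [cf df]; first exact: cf.
by split=> // i; have [di /IH] := df i.
Qed.

Lemma class_C_continuous k U f y :
  class_C k U f -> U y -> {for y, continuous f}.
Proof. by case: k => [|k] /=; [|case]; auto. Qed.

Lemma class_C_cst k U (a : R) : open U -> class_C k U (fun=> a).
Proof.
move=> oU; elim: k a => [|k IH] a /=; first by move=> y _; exact: cst_continuous.
split=> [y _|i]; first exact: cst_continuous.
split=> [y _|]; first exact: derivable_cst.
by apply: class_C_eq (IH 0) => // z Uz; rewrite /partial derive_cst.
Qed.

Lemma class_C_add k U f g : open U -> class_C k U f -> class_C k U g ->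
  class_C k U (fun y => f y + g y).
Proof.
move=> oU; elim: k f g => [|k IH] f g /=.
  by move=> cf cg y Uy; apply: continuousD; [exact: cf|exact: cg].
move=> [cf df] [cg dg]; split=> [y Uy|i].
  by apply: continuousD; [exact: cf|exact: cg].
have [dfi Cfi] := df i; have [dgi Cgi] := dg i; split=> [y Uy|].
  by apply: derivableD; [exact: dfi|exact: dgi].
apply: class_C_eq (IH _ _ Cfi Cgi) => // z Uz.
by rewrite /partial deriveD //; [exact: dfi|exact: dgi].
Qed.

Lemma class_C_mul k U f g : open U -> class_C k U f -> class_C k U g ->
  class_C k U (fun y => f y * g y).
Proof.
move=> oU; elim: k f g => [|k IH] f g /=.
  by move=> cf cg y Uy; apply: continuousM; [exact: cf|exact: cg].
move=> Cf Cg; have [Cf' Cg'] := (class_C_pred Cf, class_C_pred Cg).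
move: Cf Cg => [cf df] [cg dg]; split=> [y Uy|i].
  by apply: continuousM; [exact: cf|exact: cg].
have [dfi Cfi] := df i; have [dgi Cgi] := dg i; split=> [y Uy|].
  by apply: derivableM; [exact: dfi|exact: dgi].
apply: class_C_eq (class_C_add oU (IH _ _ Cf' Cgi) (IH _ _ Cg' Cfi)) => // z Uz.
by rewrite /partial deriveM //; [exact: dfi|exact: dgi].
Qed.

Lemma class_C_inv k U f : open U -> (forall y, U y -> f y != 0) ->
  class_C k U f -> class_C k U (fun y => (f y)^-1).
Proof.
move=> oU f0; elim: k => [|k IH] /=.
  by move=> cf y Uy; apply: continuousV; [exact: f0|exact: cf].
move=> Cf; have CV := IH (class_C_pred Cf).
move: Cf => [cf df]; split=> [y Uy|i].
  by apply: continuousV; [exact: f0|exact: cf].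
have [dfi Cfi] := df i; split=> [y Uy|].
  by apply: derivableV; [exact: f0|exact: dfi].
apply: class_C_eq (class_C_mul oU (class_C_cst k (-1) oU)
  (class_C_mul oU (class_C_mul oU CV CV) Cfi)) => // z Uz.
rewrite /partial deriveV; [|exact: f0|exact: dfi].
by rewrite /GRing.scale /= mulN1r mulNr -invfM expr2.
Qed.

Lemma smooth_continuous U f y : smooth_on U f -> U y -> {for y, continuous f}.
Proof. by move=> /(_ 0%N); exact: class_C_continuous. Qed.

Lemma near_neq U f y a : smooth_on U f -> U y -> f y != a ->
  \forall z \near y, f z != a.
Proof.
move=> Sf Uy fa; have cf : f @ y --> f y := smooth_continuous Sf Uy.
exact: (cf [set x | x != a] (open_nbhs_nbhs (conj (open_neq (y := a)) fa))).
Qed.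

Lemma open_nonzero U f : open U -> smooth_on U f ->
  open (U `&` [set y | f y != 0]).
Proof.
move=> oU Sf; rewrite openE => y [Uy fy]; apply: filterI; first exact: near_open.
exact: near_neq Sf Uy fy.
Qed.

Lemma smooth_derivable U f y i :
  smooth_on U f -> U y -> derivable f y (basis_vec R i).
Proof. by move=> /(_ 1%N)[_ /(_ i)[df _]] /df. Qed.

Lemma smooth_partial U f i : smooth_on U f -> smooth_on U (partial i f).
Proof. by move=> Sf k; have [_ /(_ i)[]] := Sf k.+1. Qed.

Lemma smooth_sub U V f : V `<=` U -> smooth_on U f -> smooth_on V f.
Proof. by move=> VU Sf k; exact: class_C_sub (Sf k). Qed.

Lemma smooth_eq U f g : open U -> (forall z, U z -> f z = g z) ->
  smooth_on U f -> smooth_on U g.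
Proof. by move=> oU fg Sf k; exact: class_C_eq (Sf k). Qed.

Lemma smooth_cst U (a : R) : open U -> smooth_on U (fun=> a).
Proof. by move=> oU k; exact: class_C_cst. Qed.

Lemma smooth_add U f g : open U -> smooth_on U f -> smooth_on U g ->
  smooth_on U (fun y => f y + g y).
Proof. by move=> oU Sf Sg k; exact: class_C_add. Qed.

Lemma smooth_mul U f g : open U -> smooth_on U f -> smooth_on U g ->
  smooth_on U (fun y => f y * g y).
Proof. by move=> oU Sf Sg k; exact: class_C_mul. Qed.

Lemma smooth_inv U f : open U -> (forall y, U y -> f y != 0) ->
  smooth_on U f -> smooth_on U (fun y => (f y)^-1).
Proof. by move=> oU f0 Sf k; exact: class_C_inv. Qed.

Lemma smooth_opp U f : open U -> smooth_on U f -> smooth_on U (fun y => - f y).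
Proof.
move=> oU Sf; apply: smooth_eq (smooth_mul oU (smooth_cst (-1) oU) Sf) => // z _.
by rewrite mulN1r.
Qed.

Lemma smooth_sum (I : finType) U (f : I -> 'rV[R]_d -> R) : open U ->
  (forall i, smooth_on U (f i)) -> smooth_on U (fun y => \sum_i f i y).
Proof.
move=> oU Sf; rewrite /index_enum; elim: (Finite.enum _) => [|i r IH].
  by apply: smooth_eq (smooth_cst 0 oU) => // z _; rewrite big_nil.
by apply: smooth_eq (smooth_add oU (Sf i) IH) => // z _; rewrite big_cons.
Qed.

Lemma smooth_prod (I : finType) U (f : I -> 'rV[R]_d -> R) : open U ->
  (forall i, smooth_on U (f i)) -> smooth_on U (fun y => \prod_i f i y).
Proof.
move=> oU Sf; rewrite /index_enum; elim: (Finite.enum _) => [|i r IH].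
  by apply: smooth_eq (smooth_cst 1 oU) => // z _; rewrite big_nil.
by apply: smooth_eq (smooth_mul oU (Sf i) IH) => // z _; rewrite big_cons.
Qed.

Lemma smooth_det e U (A : 'rV[R]_d -> 'M[R]_e) : open U ->
  (forall i j, smooth_on U (fun y => A y i j)) ->
  smooth_on U (fun y => \det (A y)).
Proof.
move=> oU SA; apply: smooth_sum => // s; apply: smooth_mul => //.
  exact: smooth_cst.
exact: smooth_prod.
Qed.

(** Cramer's rule: the entries of the inverse are cofactors divided by the
    determinant. *)
Lemma smooth_invmx e U (A : 'rV[R]_d -> 'M[R]_e) : open U ->
  (forall y, U y -> A y \in unitmx) ->
  (forall i j, smooth_on U (fun y => A y i j)) ->
  forall i j, smooth_on U (fun y => invmx (A y) i j).
Proof.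
move=> oU UA SA i j.
have Sc : smooth_on U (fun y => cofactor (A y) j i).
  apply: smooth_mul => //; first exact: smooth_cst.
  apply: smooth_det => // a b.
  by apply: smooth_eq (SA (lift j a) (lift i b)) => // z _; rewrite !mxE.
have Sd : smooth_on U (fun y => (\det (A y))^-1).
  apply: smooth_inv => // [y Uy|]; last exact: smooth_det.
  by rewrite -unitfE -unitmxE UA.
apply: smooth_eq (smooth_mul oU Sd Sc) => // z Uz.
by rewrite /invmx UA // !mxE.
Qed.

Lemma partial_add U f g i y : open U -> U y -> smooth_on U f -> smooth_on U g ->
  partial i (fun z => f z + g z) y = partial i f y + partial i g y.
Proof.
by move=> oU Uy Sf Sg; rewrite /partial deriveD //; exact: smooth_derivable Uy.
Qed.

Lemma partial_opp U f i y : U y -> smooth_on U f ->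
  partial i (fun z => - f z) y = - partial i f y.
Proof. by move=> Uy Sf; apply: deriveN; exact: smooth_derivable Uy. Qed.

Lemma partial_mul U f g i y : open U -> U y -> smooth_on U f -> smooth_on U g ->
  partial i (fun z => f z * g z) y = f y * partial i g y + g y * partial i f y.
Proof.
by move=> oU Uy Sf Sg; rewrite /partial deriveM //; exact: smooth_derivable Uy.
Qed.

Lemma partial_inv U f i y : open U -> U y -> (forall z, U z -> f z != 0) ->
  smooth_on U f -> partial i (fun z => (f z)^-1) y = - (f y ^- 2 * partial i f y).
Proof.
move=> oU Uy f0 Sf; rewrite /partial deriveV; [|exact: f0|].
  by rewrite /GRing.scale /= mulNr.
exact: smooth_derivable Uy.
Qed.

Lemma partial_coord (i j : 'I_d) (y : 'rV[R]_d) :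
  partial i (fun z => z 0 j) y = (i == j)%:R.
Proof.
rewrite /partial deriveE; last exact: differentiable_coord.
have @f : {linear 'rV[R]_d -> R}.
  by exists (fun N : 'rV[R]_d => N 0 j); do 2![eexists]; do ?[constructor];
    rewrite ?mxE// => ? *; rewrite ?mxE//; move=> ?; rewrite !mxE.
rewrite (_ : (fun _ => _) = f) // diff_lin; last exact: coord_continuous.
by rewrite /= /basis_vec mxE eqxx eq_sym.
Qed.

End SmoothFunctions.

(** * Algebra of the conformal change of connection *)

Section ConformalDifference.
Variables (R : realType) (N : nat) (G : 'M[R]_N) (ds : 'I_N -> R).

Definition gradient (k : 'I_N) : R := \sum_l invmx G k l * ds l.

Definition grad_sqnorm : R := \sum_k ds k * gradient k.

(** With [ds] the differential of [sigma], the Levi-Civita connection of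
    [sigma^-2 G] is that of [G] minus [sigma^-1] times this tensor. *)
Definition conf_diff (k i j : 'I_N) : R :=
  ds i * (k == j)%:R + ds j * (k == i)%:R - gradient k * G i j.

Lemma sum_delta (F : 'I_N -> R) (j : 'I_N) : \sum_i F i * (i == j)%:R = F j.
Proof.
rewrite (bigD1 j) //= eqxx mulr1 big1 ?addr0 // => i /negPf ->.
by rewrite mulr0.
Qed.

Hypotheses (symG : G^T = G) (unitG : G \in unitmx).

Lemma metric_sym i j : G i j = G j i.
Proof. by rewrite -{1}symG mxE. Qed.

Lemma lower_gradient j : \sum_k gradient k * G k j = ds j.
Proof.
pose v : 'cV[R]_N := \col_l ds l.
have -> : ds j = (G *m (invmx G *m v)) j 0 by rewrite mulKVmx // mxE.
rewrite mxE; apply: eq_bigr => k _; rewrite mulrC metric_sym; congr (_ * _).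
by rewrite mxE; apply: eq_bigr => l _; rewrite mxE.
Qed.

Lemma conf_diff_sym k i j : conf_diff k i j = conf_diff k j i.
Proof. by rewrite /conf_diff metric_sym; ring. Qed.

Lemma conf_diff_along a b :
  \sum_c ds c * conf_diff c a b = 2 * ds a * ds b - grad_sqnorm * G a b.
Proof.
transitivity (\sum_c (ds c * ds a * (c == b)%:R + ds c * ds b * (c == a)%:R
    - ds c * gradient c * G a b)).
  by apply: eq_bigr => c _; rewrite /conf_diff; ring.
rewrite sumrB big_split /= !sum_delta -mulr_suml -/grad_sqnorm; ring.
Qed.

Lemma conf_diff_trace b : \sum_c conf_diff c c b = N%:R * ds b.
Proof.
transitivity (\sum_c (ds c * (c == b)%:R + ds b - gradient c * G c b)).
  by apply: eq_bigr => c _; rewrite /conf_diff eqxx mulr1.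
rewrite sumrB big_split /= sum_delta lower_gradient sumr_const card_ord.
rewrite mulr_natl; ring.
Qed.

Lemma conf_diff_gradient c a :
  \sum_f conf_diff c a f * gradient f = grad_sqnorm * (c == a)%:R.
Proof.
transitivity (\sum_f (ds a * gradient f * (f == c)%:R
    + (c == a)%:R * (ds f * gradient f) - gradient c * (gradient f * G f a))).
  apply: eq_bigr => f _.
  by rewrite /conf_diff [G a f]metric_sym [f == c]eq_sym; ring.
rewrite sumrB big_split /= sum_delta -!mulr_sumr lower_gradient.
by rewrite -/grad_sqnorm; ring.
Qed.

Lemma conf_diff_quadratic a b :
  \sum_c \sum_f conf_diff c a f * conf_diff f c b =
  N.+2%:R * ds a * ds b - 2 * grad_sqnorm * G a b.
Proof.
transitivity (\sum_c (ds c * conf_diff c a b + ds b * conf_diff c c a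
    - grad_sqnorm * G c b * (c == a)%:R)).
  apply: eq_bigr => c _.
  transitivity (\sum_f (ds c * conf_diff c a f * (f == b)%:R
      + ds b * conf_diff c a f * (f == c)%:R
      - G c b * (conf_diff c a f * gradient f))).
    by apply: eq_bigr => f _; rewrite /conf_diff; ring.
  rewrite sumrB big_split /= !sum_delta -mulr_sumr conf_diff_gradient.
  by rewrite [conf_diff c c a]conf_diff_sym; ring.
rewrite sumrB big_split /= sum_delta conf_diff_along -mulr_sumr conf_diff_trace.
by rewrite -[N.+2]addn2 natrD; ring.
Qed.

(** The part of the Ricci tensor of [sigma^-2 G] quadratic in [d sigma]. The
    terms in [ds a * ds b] cancel, their coefficients being [2], [- N], [2 N]
    and [- (N + 2)]; only a multiple of the metric is left. *)
Lemma conf_diff_ricci a b :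
  \sum_c (ds c * conf_diff c a b - ds a * conf_diff c c b
    + \sum_f (conf_diff c c f * conf_diff f a b
              - conf_diff c a f * conf_diff f c b)) =
  - (N%:R - 1) * grad_sqnorm * G a b.
Proof.
rewrite big_split /= sumrB conf_diff_along -mulr_sumr conf_diff_trace.
under eq_bigr do rewrite sumrB.
rewrite sumrB conf_diff_quadratic exchange_big /=.
under eq_bigr do rewrite -mulr_suml conf_diff_trace -mulrA.
rewrite -mulr_sumr conf_diff_along -[N.+2]addn2 natrD; ring.
Qed.

Lemma conf_diff_scalar :
  \sum_a \sum_b invmx G a b *
    (\sum_c (ds c * conf_diff c a b - ds a * conf_diff c c b
      + \sum_f (conf_diff c c f * conf_diff f a b
                - conf_diff c a f * conf_diff f c b))) =
  - (N%:R * (N%:R - 1)) * grad_sqnorm.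
Proof.
transitivity (\sum_a - (N%:R - 1) * grad_sqnorm * (invmx G *m G) a a).
  apply: eq_bigr => a _; rewrite mxE mulr_sumr; apply: eq_bigr => b _.
  by rewrite conf_diff_ricci metric_sym; ring.
rewrite -mulr_sumr mulVmx //.
under eq_bigr do rewrite mxE eqxx.
by rewrite sumr_const card_ord mulr1n; ring.
Qed.

End ConformalDifference.

(** * Curvature of the rescaled metric across the zero set *)

Section ConformalRescaling.
Variables (R : realType) (n : nat) (M : manifold R n.+2).
Variables (g : M -> 'M[R]_n.+2) (s : density M) (p : M).
Local Notation N := n.+2.
Local Notation G := (tensor_comp p g).
Local Notation sigma := (s g \o cinv (chart_at p)).
Local Notation dsigma y := (fun i : 'I_N => partial i sigma y).
Local Notation ghat := (scale_metric s g).

Definition conn_diff (k i j : 'I_N) (y : 'rV[R]_N) : R :=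
  conf_diff (G y) (dsigma y) k i j.

(** [curv_linear] and [curv_quadratic] are minus the coefficient of [sigma] and
    the constant term in [sigma^2] times the curvature of the connection
    [Gamma - sigma^-1 C]. The summands [dsigma a * C] of the latter come from
    differentiating [sigma^-1]. *)
Definition curv_linear (a b e c : 'I_N) (y : 'rV[R]_N) : R :=
  partial a (conn_diff e b c) y - partial b (conn_diff e a c) y
  + \sum_f (christoffel g p e a f y * conn_diff f b c y
            + conn_diff e a f y * christoffel g p f b c y
            - christoffel g p e b f y * conn_diff f a c y
            - conn_diff e b f y * christoffel g p f a c y).

Definition curv_quadratic (a b e c : 'I_N) (y : 'rV[R]_N) : R :=
  dsigma y a * conn_diff e b c y - dsigma y b * conn_diff e a c y
  + \sum_f (conn_diff e a f y * conn_diff f b c y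
            - conn_diff e b f y * conn_diff f a c y).

(** Off the zero set this is [sigma^2] times the curvature of the rescaled
    metric; unlike that curvature, it has no singularity on the zero set. *)
Definition scaled_riemann (a b e c : 'I_N) (y : 'rV[R]_N) : R :=
  sigma y ^+ 2 * riemann g p a b e c y - sigma y * curv_linear a b e c y
  + curv_quadratic a b e c y.

(** The smooth extension of the scalar curvature of the rescaled metric: the
    factor [sigma^2] of its inverse metric is absorbed in [scaled_riemann]. *)
Definition scaled_scalar_curv (y : 'rV[R]_N) : R :=
  \sum_a \sum_b ginv g p y a b * \sum_c scaled_riemann c a c b y.

Lemma tensor_comp_scale y :
  tensor_comp p ghat y = (sigma y ^+ 2)^-1 *: G y.
Proof. by rewrite /tensor_comp /scale_metric /= -scalemxAr -scalemxAl. Qed.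

Variable U : set 'rV[R]_N.
Hypotheses (oU : open U) (Ssigma : smooth_on U sigma).
Hypothesis SG : forall i j, smooth_on U (fun y => G y i j).
Hypothesis unitG : forall y, U y -> G y \in unitmx.

Lemma ginv_scale y : U y -> sigma y != 0 ->
  ginv ghat p y = sigma y ^+ 2 *: ginv g p y.
Proof.
move=> Uy s0; rewrite /ginv tensor_comp_scale invmxZ ?invrK //.
by rewrite unitmxZ ?unitG // unitfE invr_eq0 expf_eq0 /= s0.
Qed.

Lemma smooth_ginv i j : smooth_on U (fun y => ginv g p y i j).
Proof. exact: smooth_invmx. Qed.

Lemma smooth_christoffel k i j : smooth_on U (christoffel g p k i j).
Proof.
apply: smooth_mul => //; first exact: smooth_cst.
apply: smooth_sum => // l; apply: smooth_mul => //; first exact: smooth_ginv.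
apply: smooth_add => //; last by apply: smooth_opp => //; exact: smooth_partial.
by apply: smooth_add => //; exact: smooth_partial.
Qed.

Lemma smooth_conn_diff k i j : smooth_on U (conn_diff k i j).
Proof.
have Sd l : smooth_on U (partial l sigma) by exact: smooth_partial.
apply: smooth_add => //.
  by apply: smooth_add => //; apply: smooth_mul => //; exact: smooth_cst.
apply: smooth_opp => //; apply: smooth_mul => //.
by apply: smooth_sum => // l; apply: smooth_mul => //; exact: smooth_ginv.
Qed.

Lemma smooth_scaled_scalar_curv : smooth_on U scaled_scalar_curv.
Proof.
have SC := smooth_conn_diff; have SGam := smooth_christoffel.
have SgI := smooth_ginv.
have Sp l f : smooth_on U f -> smooth_on U (partial l f).
  exact: smooth_partial.
do 2![apply: smooth_sum => // ?]; apply: smooth_mul => //.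
apply: smooth_sum => // ?; rewrite /scaled_riemann /riemann.
by do ![exact: SC | exact: SGam | exact: SgI | apply: (smooth_sum oU) => ?
  | apply: (smooth_add oU) | apply: (smooth_opp oU) | apply: (smooth_mul oU)
  | apply: Sp].
Qed.

Section OffZeroSet.
Variable V : set 'rV[R]_N.
Hypotheses (oV : open V) (VU : V `<=` U).
Hypothesis sigma_neq0 : forall y, V y -> sigma y != 0.

Lemma partial_metric_scale y i a b : V y ->
  partial i (fun z => tensor_comp p ghat z a b) y =
  (sigma y ^+ 2)^-1 * partial i (fun z => G z a b) y
  - 2 * (sigma y ^+ 3)^-1 * partial i sigma y * G y a b.
Proof.
move=> Vy; have s0 := sigma_neq0 Vy.
have SsV : smooth_on V sigma by exact: smooth_sub Ssigma.
have SV : smooth_on V (fun z => (sigma z)^-1) by exact: smooth_inv.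
(* [sigma^-2] is split into two factors so that the rule for inverses applies
   to [sigma] itself. *)
rewrite (_ : (fun z => _) =
    fun z => (sigma z)^-1 * ((sigma z)^-1 * G z a b)); last first.
  apply/funext => z; rewrite tensor_comp_scale mxE expr2 invfM; ring.
have SGV : smooth_on V (fun z => G z a b) by exact: smooth_sub (SG a b).
rewrite !(partial_mul _ oV Vy) //; last exact: smooth_mul.
rewrite (partial_inv _ oV Vy) //=.
by field.
Qed.

Lemma christoffel_scale k i j y : V y ->
  christoffel ghat p k i j y =
  christoffel g p k i j y - (sigma y)^-1 * conn_diff k i j y.
Proof.
move=> Vy; have s0 := sigma_neq0 Vy; have Uy := VU Vy.
have delta a : (k == a)%:R = \sum_l ginv g p y k l * G y l a.
  have /matrixP/(_ k a) := mulVmx (unitG Uy).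
  by rewrite !mxE => ->.
have -> : conn_diff k i j y = \sum_l ginv g p y k l *
    (dsigma y i * G y l j + dsigma y j * G y l i - dsigma y l * G y i j).
  rewrite /conn_diff /conf_diff !delta /gradient !mulr_sumr mulr_suml.
  rewrite -big_split /= -sumrB; apply: eq_bigr => l _; rewrite /ginv; ring.
rewrite /christoffel !mulr_sumr -sumrB; apply: eq_bigr => l _.
rewrite !partial_metric_scale // ginv_scale // [in LHS]mxE.
by move: s0 => /= s0; field.
Qed.

Lemma partial_christoffel_scale l k i j y : V y ->
  partial l (christoffel ghat p k i j) y =
  partial l (christoffel g p k i j) y
  - (sigma y)^-1 * partial l (conn_diff k i j) y
  + (sigma y ^+ 2)^-1 * dsigma y l * conn_diff k i j y.
Proof.
move=> Vy; have s0 := sigma_neq0 Vy.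
have SsV : smooth_on V sigma by exact: smooth_sub Ssigma.
have SV : smooth_on V (fun z => (sigma z)^-1) by exact: smooth_inv.
have SGam : smooth_on V (christoffel g p k i j).
  by apply: smooth_sub (smooth_christoffel k i j).
have SC : smooth_on V (conn_diff k i j).
  by apply: smooth_sub (smooth_conn_diff k i j).
rewrite (partial_eq_on _ oV Vy (g := fun z => christoffel g p k i j z
    + (- (sigma z)^-1) * conn_diff k i j z)); last first.
  by move=> z Vz; rewrite christoffel_scale // mulNr.
have SNV : smooth_on V (fun z => - (sigma z)^-1) by exact: smooth_opp.
rewrite (partial_add _ oV Vy) //; last exact: smooth_mul.
rewrite (partial_mul _ oV Vy SNV SC).
have -> : partial l (fun z => - (sigma z)^-1) y =
    - partial l (fun z => (sigma z)^-1) y by exact: partial_opp Vy SV.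
rewrite (partial_inv _ oV Vy) //=; ring.
Qed.

Lemma riemann_scale a b e c y : V y ->
  sigma y ^+ 2 * riemann ghat p a b e c y = scaled_riemann a b e c y.
Proof.
move=> Vy; have s0 := sigma_neq0 Vy.
rewrite /riemann !partial_christoffel_scale //.
under eq_bigr do rewrite !christoffel_scale //.
set S := (X in _ + X).
pose S0 := \sum_f (christoffel g p e a f y * christoffel g p f b c y
                   - christoffel g p e b f y * christoffel g p f a c y).
pose S1 := \sum_f (christoffel g p e a f y * conn_diff f b c y
                   + conn_diff e a f y * christoffel g p f b c y
                   - christoffel g p e b f y * conn_diff f a c y
                   - conn_diff e b f y * christoffel g p f a c y).
pose S2 := \sum_f (conn_diff e a f y * conn_diff f b c y
                   - conn_diff e b f y * conn_diff f a c y).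
have -> : S = S0 - (sigma y)^-1 * S1 + (sigma y ^+ 2)^-1 * S2.
  rewrite /S0 /S1 /S2 !mulr_sumr -sumrB -big_split /=; apply: eq_bigr => f _.
  move: (christoffel g p e a f y) (christoffel g p f b c y) => G1 G2.
  move: (christoffel g p e b f y) (christoffel g p f a c y) => G3 G4.
  move: (conn_diff e a f y) (conn_diff f b c y) => C1 C2.
  move: (conn_diff e b f y) (conn_diff f a c y) => C3 C4.
  by move: s0 => /= s0; field.
rewrite /scaled_riemann /riemann /curv_linear /curv_quadratic -/S0 -/S1 -/S2.
(* The geometric quantities are made opaque: only the dependence on
   [sigma y] matters for the identity. *)
move: S0 S1 S2 => S0 S1 S2.
move: (partial a (christoffel g p e b c) y) => G1.
move: (partial b (christoffel g p e a c) y) => G2.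
move: (partial a (conn_diff e b c) y) (partial b (conn_diff e a c) y) => C1 C2.
move: (conn_diff e b c y) (conn_diff e a c y) => C3 C4.
by move: s0 => /= s0; field.
Qed.

Lemma scalar_curv_scale y : V y ->
  scalar_curv ghat p y = scaled_scalar_curv y.
Proof.
move=> Vy; have s0 := sigma_neq0 Vy.
rewrite /scalar_curv /metric_trace /scaled_scalar_curv.
apply: eq_bigr => a _; apply: eq_bigr => b _.
rewrite ginv_scale //; last exact: VU.
rewrite !mxE [_ * ginv _ _ _ _ _]mulrC -mulrA mulr_sumr; congr (_ * _).
by apply: eq_bigr => c _; rewrite riemann_scale.
Qed.

End OffZeroSet.

Lemma scaled_scalar_curv_zero y : U y -> sigma y = 0 -> (G y)^T = G y ->
  scaled_scalar_curv y =
  - (N%:R * (N%:R - 1)) * grad_sqnorm (G y) (dsigma y).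
Proof.
move=> Uy s0 symG; rewrite -conf_diff_scalar ?unitG //.
apply: eq_bigr => a _; apply: eq_bigr => b _; congr (_ * _).
apply: eq_bigr => c _; rewrite /scaled_riemann s0 expr0n /=.
by rewrite !mul0r oppr0 !add0r.
Qed.

(** If the extension took another value than [kappa] at the zero [y], it would
    differ from [kappa] on a neighbourhood of [y], where [sigma] would have to
    vanish identically, contradicting [d sigma <> 0] at [y]. *)
Lemma scalar_curv_at_zero (kappa : R) y : U y -> sigma y = 0 ->
  (G y)^T = G y -> (exists i, dsigma y i != 0) ->
  (forall z, U z -> sigma z != 0 -> scalar_curv ghat p z = kappa) ->
  kappa = - (N%:R * (N%:R - 1)) * grad_sqnorm (G y) (dsigma y).
Proof.
move=> Uy s0 symG [i /eqP di0] Hk; rewrite -scaled_scalar_curv_zero //.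
pose V := U `&` [set z | sigma z != 0].
have oV : open V by exact: open_nonzero.
have VU : V `<=` U by move=> z [].
have Vs z : V z -> sigma z != 0 by case.
apply/eqP/negPn/negP; rewrite eq_sym => ne; apply: di0.
rewrite -[RHS](derive_cst 0 y (basis_vec R i)); apply: near_eq_derive.
have nk := near_neq smooth_scaled_scalar_curv Uy ne.
apply: filterS (filterI nk (near_open oU Uy)) => z [Fz Uz] /=.
apply/eqP/negPn/negP => sz; move/eqP: Fz; apply.
by rewrite -(scalar_curv_scale oV VU Vs) ?Hk.
Qed.

End ConformalRescaling.

(** * Normals to the zero set *)

Section NormalVectors.
Variables (R : realType) (N : nat) (G : 'M[R]_N) (ds : 'cV[R]_N).
Hypotheses (symG : G^T = G) (unitG : G \in unitmx).

Lemma grad_sqnormE :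
  grad_sqnorm G (fun i => ds i 0) = sc (ds^T *m (invmx G *m ds)).
Proof. by rewrite /sc mxE; apply: eq_bigr => k _; rewrite !mxE. Qed.

Lemma sqnorm_multiple (c : R) (v : 'rV[R]_N) : v *m G = c *: ds^T ->
  sc (v *m G *m v^T) = c ^+ 2 * grad_sqnorm G (fun i => ds i 0).
Proof.
move=> vG; have vE : v = c *: (ds^T *m invmx G).
  by rewrite scalemxAl -vG mulmxK.
rewrite vG {1}vE linearZ /= trmx_mul trmxK trmx_inv symG grad_sqnormE.
by rewrite -scalemxAr -scalemxAl scalerA /sc mxE expr2.
Qed.

(** Two linear forms with nested kernels are proportional: where
    [ds i 0 != 0], the hypothesis is applied to the vectors
    [e_j - (ds_j / ds_i) e_i], which span the kernel of [ds]. *)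
Lemma normal_multiple (v : 'rV[R]_N) : ds != 0 ->
  (forall w : 'rV[R]_N, w *m ds = 0 -> v *m G *m w^T = 0) ->
  exists c, v *m G = c *: ds^T.
Proof.
move=> ds0 vn; have [i di0] : exists i, ds i 0 != 0.
  apply/existsP; apply: contraNT ds0 => /existsPn ds0.
  by apply/eqP/colP => i; rewrite mxE; apply/eqP/negPn/ds0.
exists ((v *m G) 0 i / ds i 0); apply/rowP => j.
pose w : 'rV[R]_N := delta_mx 0 j - (ds j 0 / ds i 0) *: delta_mx 0 i.
have /vn : w *m ds = 0.
  apply/matrixP => a b; rewrite !ord1 mulmxBl -scalemxAl -!rowE !mxE.
  by rewrite divfK // subrr.
rewrite linearB linearZ /= !trmx_delta mulmxBr -scalemxAr -!colE.
move/matrixP => /(_ 0 0); rewrite !mxE => /subr0_eq ->.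
by rewrite mulrC mulrAC mulrA.
Qed.

End NormalVectors.

Section ChartCentre.
Variables (R : realType) (d : nat) (M : manifold R d) (p : M).

Lemma open_in_chart : open (in_chart p setT).
Proof. by rewrite /in_chart setIT; exact: cimg_open. Qed.

Lemma coords_in_chart : in_chart p setT (coords p).
Proof. by exists p => //; split=> //; exact: chart_at_dom. Qed.

Lemma cinv_coords : cinv (chart_at p) (coords p) = p.
Proof. exact/cmapK/chart_at_dom. Qed.

(** At the centre the two charts of the transition map coincide, so it is the
    identity near that point. *)
Lemma coord_frame_centre : coord_frame p (coords p) = 1%:M.
Proof.
apply/matrixP => i j; rewrite /coord_frame cinv_coords !mxE.
rewrite (partial_eq_on i open_in_chart coords_in_chart
  (g := fun z => z 0 j)) ?partial_coord // => z [x [Dx _] <-] /=.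
by rewrite cmapK.
Qed.

Lemma tensor_comp_centre (g : M -> 'M[R]_d) : tensor_comp p g (coords p) = g p.
Proof.
by rewrite /tensor_comp coord_frame_centre cinv_coords trmx1 mul1mx mulmx1.
Qed.

End ChartCentre.

Section ZeroSetNormals.
Variables (R : realType) (n : nat) (M : manifold R n.+2).
Implicit Types (g : M -> 'M[R]_n.+2) (s : density M) (p x : M).

Lemma lorentzian_sym g x : lorentzian g -> (g x)^T = g x.
Proof.
case=> _ /(_ x)[B uB]; set D := diag_mx _ => BgB.
have uBT : B^T \in unitmx by rewrite unitmx_tr.
have -> : g x = invmx B *m D *m invmx B^T.
  by rewrite -BgB -!mulmxA mulmxV // mulmx1 mulKmx.
by rewrite !trmx_mul tr_diag_mx !trmx_inv trmxK mulmxA.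
Qed.

Lemma lorentzian_unit g x : lorentzian g -> g x \in unitmx.
Proof.
case=> _ /(_ x)[B uB BgB].
suff : B *m g x *m B^T \in unitmx by rewrite !unitmx_mul => /andP[/andP[]].
rewrite BgB unitmxE det_diag unitfE; apply/prodf_neq0 => i _.
by rewrite mxE; case: ifP; rewrite ?oppr_eq0 oner_eq0.
Qed.

(** The open set on which the local analysis is done is the part of the chart
    centred at [p] where the components of [g] form an invertible matrix. *)
Lemma scalar_curv_zero_set g s p (kappa : R) : lorentzian g ->
  smooth_fun setT (s g) -> dfun (s g) p != 0 -> zero_set s g p ->
  const_scalar_curv (~` zero_set s g) (scale_metric s g) kappa ->
  kappa = - (n.+2%:R * n.+1%:R) *
          grad_sqnorm (g p) (fun i => dfun (s g) p i 0).
Proof.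
move=> Lg Ss ds0 sp0 Hk.
have oD := @open_in_chart _ _ _ p; have Dp := @coords_in_chart _ _ _ p.
pose U := in_chart p setT `&`
  [set y | \det (tensor_comp p g y) != 0].
have SG i j : smooth_on (in_chart p setT) (fun y => tensor_comp p g y i j).
  by case: Lg => SG _; exact: SG.
have UD : U `<=` in_chart p setT by move=> y [].
have oU : open U by apply: open_nonzero => //; exact: smooth_det.
have Up : U (coords p).
  split=> //=; rewrite tensor_comp_centre -unitfE -unitmxE.
  exact: lorentzian_unit.
have sc0 : (s g \o cinv (chart_at p)) (coords p) = 0 by rewrite /= cinv_coords.
rewrite (scalar_curv_at_zero (p := p) oU _ _ _ Up sc0 _ _ (kappa := kappa)).
- rewrite tensor_comp_centre; congr (- (_ * _) * _).
    by rewrite -[n.+2]addn1 natrD addrK.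
  by congr grad_sqnorm; apply/funext => i; rewrite mxE.
- by apply: smooth_sub UD _; exact: Ss.
- by move=> i j; apply: smooth_sub UD _; exact: SG.
- by move=> y []; rewrite unitmxE unitfE.
- by rewrite tensor_comp_centre; exact: lorentzian_sym.
- apply/existsP; apply: contraNT ds0 => /existsPn ds0.
  by apply/eqP/colP => i; rewrite !mxE; apply/eqP/negPn/ds0.
- move=> z [[x [Dx _] <-] _] /=; rewrite cmapK // => sx; apply: Hk => //.
  by move=> /= /eqP; apply/negP.
Qed.

(** Along [v G = c d sigma], both [Lambda] and [g(v,v)] are multiples of
    [|d sigma|^2], by [- (N - 1)] and [c^2] respectively. *)
Lemma normal_sqnorm_sign g s p (Lambda : R) v : lorentzian g ->
  smooth_fun setT (s g) -> dfun (s g) p != 0 -> zero_set s g p ->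
  const_scalar_curv (~` zero_set s g) (scale_metric s g) (n.+2%:R * Lambda) ->
  is_normal g (s g) p v ->
  exists2 a : R, 0 < a & Lambda = - a * sc (v *m g p *m v^T).
Proof.
move=> Lg Ss ds0 sp0 Hk [v0 vn].
have [c vG] := normal_multiple ds0 vn.
have c0 : c != 0.
  apply: contraNneq v0 => c0; rewrite c0 scale0r in vG.
  by rewrite -(mulmxK (lorentzian_unit p Lg) v) vG mul0mx.
exists (n.+1%:R / c ^+ 2).
  by rewrite divr_gt0 ?ltr0Sn // lt_neqAle eq_sym expf_eq0 /= c0 sqr_ge0.
rewrite (sqnorm_multiple _ _ vG) ?lorentzian_sym ?lorentzian_unit //.
have n0 : (n.+2%:R : R) != 0 by rewrite pnatr_eq0.
apply: (mulfI n0); rewrite (scalar_curv_zero_set Lg Ss ds0 sp0 Hk).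
by move: c0; move: (grad_sqnorm _ _) => q c0; field.
Qed.

(** The gradient is a normal; without one at some point of the zero set, all
    three causal types would hold vacuously. *)
Lemma normal_exists g s p : lorentzian g -> dfun (s g) p != 0 ->
  exists v, is_normal g (s g) p v.
Proof.
move=> Lg ds0; have uG := lorentzian_unit p Lg.
exists ((dfun (s g) p)^T *m invmx (g p)); split=> [|w wd].
  apply: contraNneq ds0 => v0.
  by rewrite -[dfun _ _]trmxK -(mulmxKV uG (dfun _ _)^T) v0 mul0mx trmx0.
by rewrite mulmxKV // -trmx_mul wd trmx0.
Qed.

End ZeroSetNormals.

(** * The trichotomy *)

Theorem proposition7p1 (R : realType) (m : nat) (hm : (0 < m)%N)
  (M : manifold R m.*2.+1) (X : almost_CR M) (E : density_root X)
  (F : circle_bundle E)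
  (k : F -> 'rV[R]_(m.*2.+2)) (xi : F -> 'cV[R]_(m.*2.+2))
  (c : set (F -> 'M[R]_(m.*2.+2)))
  (hc : perturbed_fefferman_space k xi c)
  (s : density F)
  (hs : almost_half_einstein_scale (@Ntilde R m M X E F) c s)
  (hZ : exists2 g, c g & zero_set s g !=set0)
  (Lambda : R)
  (hL : forall g, c g ->
     half_einstein_on (@Ntilde R m M X E F) (~` zero_set s g) (scale_metric s g) /\
     const_scalar_curv (~` zero_set s g) (scale_metric s g)
       ((m.*2.+2)%:R * Lambda)) :
  [/\ zero_set_null c s <-> Lambda = 0,
      zero_set_spacelike c s <-> 0 < Lambda &
      zero_set_timelike c s <-> Lambda < 0].
Proof.
have [_ _ [theta [g0 [_ _ cE]]]] := hc.
have Lor g : c g -> lorentzian g by rewrite cE => -[].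
have [[dens ds0] _] := hs.
have key g x v : c g -> zero_set s g x -> is_normal g (s g) x v ->
    exists2 a : R, 0 < a & Lambda = - a * sc (v *m g x *m v^T).
  move=> cg sx; apply: normal_sqnorm_sign => //; first exact: Lor.
  - by have [] := dens g cg.
  - exact: ds0.
  - by have [] := hL g cg.
have [g cg [x sx]] := hZ.
have [v nv] := normal_exists (Lor g cg) (ds0 g x cg sx).
have [a a0 LE] := key g x v cg sx nv.
split; split.
- by move=> /(_ g x v cg sx nv) q0; rewrite LE q0 mulr0.
- move=> L0 g' x' v' cg' sx' nv'; have [b b0 L'E] := key _ _ _ cg' sx' nv'.
  move/eqP: L'E; rewrite L0 eq_sym mulf_eq0 oppr_eq0 (gt_eqF b0) /=.
  by move/eqP.
- by move=> /(_ g x v cg sx nv) q0; rewrite LE nmulr_rgt0 // oppr_lt0.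
- move=> L0 g' x' v' cg' sx' nv'; have [b b0 L'E] := key _ _ _ cg' sx' nv'.
  by rewrite L'E nmulr_rgt0 ?oppr_lt0 in L0.
- by move=> /(_ g x v cg sx nv) q0; rewrite LE nmulr_rlt0 // oppr_lt0.
- move=> L0 g' x' v' cg' sx' nv'; have [b b0 L'E] := key _ _ _ cg' sx' nv'.
  by rewrite L'E nmulr_rlt0 ?oppr_lt0 in L0.
Qed.
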